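(* Let $G$ be a cyclic group of order $n=\prod_{i=1}^{m}p_i^{a_i}$, where $p_1,\dots,p_m$ are distinct primes and $a_1,\dots,a_m\ge 1$. Then $$\mathcal{V}(G)=\frac{\omega(n)}{\tau(n)}=\frac{m}{\prod_{i=1}^{m}(a_i+1)}.$$
   Context: For a finite group $G$, $L(G)$ denotes the set of all subgroups of $G$ (including the trivial subgroup and $G$ itself), $s(G)$ denotes the number of subgroups of $G$ that are simple groups (the trivial group is not simple; cyclic groups of prime order are simple), and $\mathcal{V}(G)=s(G)/|L(G)|$. $\omega(n)$ is the number of distinct prime factors of $n$ and $\tau(n)$ is the number of positive divisors of $n$. *)

(* Defs.v *)
From mathcomp Require Import all_boot all_order all_algebra all_fingroup all_solvable.

Set Implicit Arguments.
Unset Strict Implicit.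
Unset Printing Implicit Defensive.

Import GRing.Theory Num.Theory.

Definition num_simple_subgroups (gT : finGroupType) (G : {group gT}) : nat :=
  #|[set H in subgroups G | simple H]|.

Definition simple_ratio (gT : finGroupType) (G : {group gT}) : rat :=
  ((num_simple_subgroups G)%:R / #|subgroups G|%:R)%R.

Definition omega (n : nat) : nat := size (primes n).

(* [divisors 0] is [:: 1], so this is the divisor count only for n > 0. *)
Definition tau (n : nat) : nat := size (divisors n).

(* Main.v *)
Require Import Defs.
From mathcomp Require Import all_boot all_order all_algebra all_fingroup all_solvable.

(** In a cyclic group of order [n], a subgroup is determined by its order, every
    divisor of [n] occurs as an order, and a subgroup is simple exactly when its
    order is prime; so subgroups correspond to the divisors of [n] and simple
    subgroups to its prime divisors. The closed form follows since the number of
    divisors is multiplicative on coprime factors. *)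

Lemma divisors_gt0 d n : d \in divisors n -> 0 < d.
Proof.
case: n => [|n]; first by rewrite inE => /eqP->.
by rewrite -dvdn_divisors //; apply: dvdn_gt0.
Qed.

(** Multiplication maps pairs of a divisor of [m] and a divisor of [n] bijectively onto the divisors
    of [m * n]. *)
Lemma tauM m n : 0 < m -> 0 < n -> coprime m n -> tau (m * n) = tau m * tau n.
Proof.
move=> m_gt0 n_gt0 co_mn; rewrite /tau -(size_allpairs muln).
apply/perm_size/uniq_perm; first exact: divisors_uniq.
  apply: allpairs_uniq; rewrite ?divisors_uniq // => x y.
  case/allpairsP=> -[d e] /= [d_m e_n ->] /allpairsP[[d' e'] /= [d'_m e'_n ->]].
  (* Injectivity: as [v] is coprime to [m], the gcd with [m] recovers [u] from [u * v]; cancelling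
     it then recovers [v]. *)
  have gcdK u v : u \in divisors m -> v \in divisors n -> gcdn m (u * v) = u.
    rewrite -!dvdn_divisors // => u_m v_n.
    rewrite Gauss_gcdl; first exact/gcdn_idPr.
    exact: coprime_dvdr co_mn.
  move=> eq_de.
  have eq_d: d = d' by rewrite -(gcdK d e) // -(gcdK d' e') // eq_de.
  by move/eqP: eq_de; rewrite eq_d eqn_pmul2l ?(divisors_gt0 _ m) // => /eqP->.
move=> d; rewrite -dvdn_divisors ?muln_gt0 ?m_gt0 //.
apply/idP/allpairsP => [d_mn | [[u v] /= [u_m v_n ->]]]; last first.
  by rewrite dvdn_mul // dvdn_divisors.
have g_gt0: 0 < gcdn d m by rewrite gcdn_gt0 m_gt0 orbT.
(* The cofactor divides [n] because [d] divides both [n * d] and [n * m], hence their gcd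
   [n * gcdn d m]. *)
exists (gcdn d m, d %/ gcdn d m) => /=.
rewrite -!dvdn_divisors // dvdn_gcdr dvdn_divLR ?dvdn_gcdl //.
split=> //; last by rewrite mulnC divnK ?dvdn_gcdl.
by rewrite muln_gcdr dvdn_gcd dvdn_mull //= mulnC.
Qed.

Lemma tau_prime_exp p k : prime p -> tau (p ^ k) = k.+1.
Proof.
move=> p_pr; rewrite /tau -[RHS](size_iota 0) -[RHS](size_map (expn p)).
apply/perm_size/uniq_perm; first exact: divisors_uniq.
  by rewrite map_inj_uniq ?iota_uniq //; apply: expnI; apply: prime_gt1.
move=> d; rewrite -dvdn_divisors ?expn_gt0 ?prime_gt0 //.
apply/(dvdn_pfactor _ _ p_pr)/mapP => -[j].
  by move=> le_jk ->; exists j; rewrite ?mem_iota.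
by rewrite mem_iota => le_jk ->; exists j.
Qed.

Section PrimePowerProduct.

Variables (I : eqType) (p a : I -> nat).
Hypotheses (p_prime : forall i, prime (p i)) (p_inj : injective p).

Lemma prime_exp_prod_gt0 r : 0 < \prod_(i <- r) p i ^ a i.
Proof. by apply: prodn_gt0 => i; rewrite expn_gt0 prime_gt0. Qed.

Lemma tau_prod_prime_exp r :
  uniq r -> tau (\prod_(i <- r) p i ^ a i) = \prod_(i <- r) (a i).+1.
Proof.
elim: r => [|i r IHr] /=; first by rewrite !big_nil.
case/andP=> i_r r_uniq; rewrite !big_cons tauM ?prime_exp_prod_gt0 //.
- by rewrite tau_prime_exp // IHr.
- by rewrite expn_gt0 prime_gt0.
(* The new prime power is coprime to the rest: [big_seq] retains [j \in r], so [i] differs from [j],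
   and [p] is injective. *)
rewrite big_seq; elim/big_ind: _ => [|x y co_x co_y|j j_r]; first exact: coprimen1.
  by rewrite coprimeMr co_x.
apply/coprimeXl/coprimeXr; rewrite prime_coprime // dvdn_prime2 //.
by apply: contra i_r => /eqP/p_inj->.
Qed.

Lemma mem_primes_prod_prime_exp r q :
  (forall i, 0 < a i) ->
  (q \in primes (\prod_(i <- r) p i ^ a i)) = (q \in map p r).
Proof.
move=> a_gt0; elim: r => [|i r IHr]; first by rewrite big_nil.
rewrite big_cons primesM ?prime_exp_prod_gt0 ?expn_gt0 ?prime_gt0 //.
by rewrite primesX // primes_prime // IHr !inE.
Qed.

Lemma omega_prod_prime_exp r :
  uniq r -> (forall i, 0 < a i) -> omega (\prod_(i <- r) p i ^ a i) = size r.
Proof.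
move=> r_uniq a_gt0; rewrite /omega -[RHS](size_map p).
apply/perm_size/uniq_perm; rewrite ?primes_uniq ?map_inj_uniq // => q.
exact: mem_primes_prod_prime_exp.
Qed.

End PrimePowerProduct.

Section CyclicSubgroups.

Local Open Scope group_scope.

Variables (gT : finGroupType) (G : {group gT}).
Hypothesis G_cyclic : cyclic G.

Lemma cyclic_subgroup_of_order d :
  d %| #|G| -> exists2 H : {group gT}, H \subset G & #|H| = d.
Proof.
case/cyclicP: G_cyclic => x defG; rewrite defG => d_x.
(* For a generator [x], the power [x ^+ (#[x] %/ d)] has order [d]. *)
have /setP/(_ <[x ^+ (#[x] %/ d)]>%G) := cycle_sub_group d_x.
rewrite !inE eqxx => /andP[sHG /eqP oH].
by exists <[x ^+ (#[x] %/ d)]>%G.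
Qed.

(** Taking the order is a bijection from subgroups to divisors. A general [P] lets one count serve
    twice: [xpredT] for all subgroups, [prime] for the simple ones. *)
Lemma card_subgroups_of_order (P : pred nat) :
  #|[set H in subgroups G | P #|H|]| = size (filter P (divisors #|G|)).
Proof.
rewrite cardE -(size_map (fun H : {group gT} => #|H|)).
apply/perm_size/uniq_perm; rewrite ?filter_uniq ?divisors_uniq //.
  rewrite map_inj_in_uniq ?enum_uniq // => H K.
  rewrite !mem_enum !inE => /andP[sHG _] /andP[sKG _] /eqP eq_HK.
  by apply/val_inj/eqP; rewrite (eq_subG_cyclic G_cyclic).
move=> d; rewrite mem_filter -dvdn_divisors ?cardG_gt0 //.
apply/mapP/andP => [[H] | [Pd d_G]].
  by rewrite mem_enum !inE => /andP[sHG PH] ->; rewrite cardSg.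
have [H sHG oH] := cyclic_subgroup_of_order d d_G.
by exists H; rewrite ?mem_enum ?inE ?sHG oH.
Qed.

Lemma card_subgroups_cyclic : #|subgroups G| = tau #|G|.
Proof.
have := card_subgroups_of_order xpredT; rewrite filter_predT /tau => <-.
by apply: eq_card => H; rewrite !inE andbT.
Qed.

Lemma num_simple_subgroups_cyclic : num_simple_subgroups G = omega #|G|.
Proof.
transitivity #|[set H in subgroups G | prime #|H|]|.
  apply: eq_card => H; rewrite !inE; apply: andb_id2l => sHG.
  apply/idP/idP => [|H_pr].
    (* Subgroups of [G] are abelian, hence solvable, and a solvable simple group has prime order. *)
    by apply/simple_sol_prime/abelian_sol/(abelianS sHG)/cyclic_abelian.
  apply/simpleP; split=> [|K /andP[sKH _]].
    by rewrite -cardG_gt1 prime_gt1.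
  (* By Lagrange, [#|K|] divides the prime [#|H|], so [K] is trivial or all of [H]. *)
  have /primeP[_ /(_ _ (cardSg sKH))] := H_pr.
  case/orP=> [K1 | /eqP oK]; [left | right].
    exact/card1_trivg/eqP.
  by apply/eqP; rewrite eqEcard sKH oK /=.
rewrite card_subgroups_of_order /omega.
apply/perm_size/uniq_perm; rewrite ?filter_uniq ?divisors_uniq ?primes_uniq //.
by move=> q; rewrite mem_filter mem_primes cardG_gt0 -dvdn_divisors.
Qed.

End CyclicSubgroups.

Theorem proposition2p5 (gT : finGroupType) (G : {group gT}) (n m : nat)
    (p a : 'I_m -> nat)
    (p_prime : forall i : 'I_m, prime (p i))
    (p_inj : injective p)
    (a_ge1 : forall i : 'I_m, 1 <= a i)
    (n_eq : n = \prod_(i < m) p i ^ a i)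
    (G_cyclic : cyclic G)
    (G_order : #|G| = n) :
  simple_ratio G = ((omega n)%:R / (tau n)%:R)%R /\
  ((omega n)%:R / (tau n)%:R)%R = (m%:R / (\prod_(i < m) (a i + 1)%N)%:R)%R :> rat.
Proof.
split.
  rewrite /simple_ratio num_simple_subgroups_cyclic //.
  by rewrite card_subgroups_cyclic // G_order.
(* The product over [i < m] runs over [index_enum 'I_m], a duplicate-free list of length [m], so the
   list lemmas apply. *)
have I_uniq := index_enum_uniq 'I_m.
have size_I: size (index_enum 'I_m) = m.
  by rewrite -[RHS]card_ord cardT enumT.
rewrite n_eq omega_prod_prime_exp // tau_prod_prime_exp // size_I.
by under [in RHS]eq_bigr do rewrite addn1.
Qed.
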